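(* Let $\mathcal{G}$ be a subgraph-closed class of graphs with bounded maximum degree. If $\mathcal{G}$ has strongly sublinear separators, then there exists $\gamma\ge 0$ such that the expansion of $\mathcal{G}$ is bounded by $f(k)=\gamma e^{k^{3/4}}$. Hence, $\mathcal{G}$ has subexponential expansion.
   Context: All graphs are finite and simple. For a graph $G$ and an integer $k\ge 0$, a $k$-minor of $G$ is any graph obtained from $G$ by contracting pairwise vertex-disjoint connected subgraphs of radius at most $k$ and removing vertices and edges (so a $0$-minor is a subgraph). Let $\nabla_k(G)=\max\{|E(G')|/|V(G')| : G' \text{ is a } k\text{-minor of } G\}$, and for a class $\mathcal{G}$ let $\nabla_k(\mathcal{G})$ be the supremum of $\nabla_k(G)$ over $G\in\mathcal{G}$. A function $f$ bounds the expansion of $\mathcal{G}$ if $f(k)\ge\nabla_k(\mathcal{G})$ for every integer $k\ge 0$. $\mathcal{G}$ has subexponential expansion if $\lim_{k\to\infty}\frac{\log\nabla_k(\mathcal{G})}{k}=0$. A separation of $G$ is a pair $(A,B)$ of edge-disjoint subgraphs with $A\cup B=G$; its size is $|V(A)\cap V(B)|$; it is balanced if $|V(A)\setminus V(B)|\le 2|V(G)|/3$ and $|V(B)\setminus V(A)|\le 2|V(G)|/3$. For a class $\mathcal{C}$, $s_{\mathcal{C}}(n)$ is the smallest nonnegative integer such that every graph in $\mathcal{C}$ with at most $n$ vertices has a balanced separation of size at most $s_{\mathcal{C}}(n)$. $\mathcal{C}$ has strongly sublinear separators if there are constants $c\ge1$ and $0\le\delta<1$ with $s_{\mathcal{C}}(n)\le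 cn^{\delta}$ for all $n\ge 0$. A class is subgraph-closed if every subgraph of a graph in the class belongs to the class. *)

(* Defs.v *)
From HB Require Import structures.
From mathcomp Require Import all_boot all_order all_algebra.
From mathcomp Require Import all_classical all_reals all_analysis.
Set Implicit Arguments.
Unset Strict Implicit.
Unset Printing Implicit Defensive.
Import Order.TTheory GRing.Theory Num.Theory.
Import numFieldNormedType.Exports.
Local Open Scope classical_set_scope.
Local Open Scope ring_scope.

Record graph := Graph {
  vertex :> finType;
  edges : {set {set vertex}};
  edges_card2 : forall e, e \in edges -> #|e| = 2
}.

Definition adj (G : graph) : rel G := fun x y => [set x; y]%SET \in edges G.

Definition degree (G : graph) (x : G) : nat := #|[set y | adj x y]%SET|.

Definition max_degree (G : graph) : nat := \max_(x : G) degree x.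

Definition iso (G H : graph) : Prop :=
  exists2 f : G -> H, bijective f & forall x y, adj (f x) (f y) = adj x y.

Definition gconnected (G : graph) : Prop :=
  (0 < #|G|)%N /\ forall x y : G, connect (@adj G) x y.

Definition dist_le (G : graph) (k : nat) (x y : G) : Prop :=
  exists p : seq G, [/\ path (@adj G) x p, last x p = y & (size p <= k)%N].

Definition radius_le (G : graph) (k : nat) : Prop :=
  exists c : G, forall x : G, dist_le k c x.

Record subgraph (G : graph) := Subgraph {
  sub_verts : {set G};
  sub_edges : {set {set G}};
  sub_edgesG : sub_edges \subset edges G;
  sub_edges_verts : forall e, e \in sub_edges -> e \subset sub_verts
}.

Section GraphOfSub.
Variables (G : graph) (S : subgraph G).

Definition gos_edges : {set {set {x : G | x \in sub_verts S}}} :=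
  [set e : {set {x : G | x \in sub_verts S}} |
    [set val x | x in e]%SET \in sub_edges S]%SET.

Lemma gos_edges_card2 e : e \in gos_edges -> #|e| = 2.
Proof.
rewrite inE => /(fintype.subsetP (sub_edgesG S)) /edges_card2.
by rewrite card_imset //; exact: val_inj.
Qed.

Definition graph_of_sub : graph := Graph gos_edges_card2.
End GraphOfSub.
Coercion graph_of_sub : subgraph >-> graph.

Section Contract.
Variables (G : graph) (m : nat) (S : 'I_m -> subgraph G).

(* One vertex for each contracted subgraph, besides the vertices of G that lie
   in none of them. *)
Definition contract_vertex : finType :=
  ('I_m + {x : G | x \notin \bigcup_i sub_verts (S i)}%SET)%type.

Definition block (u : contract_vertex) : {set G} :=
  match u with
  | inl i => sub_verts (S i)
  | inr x => [set val x]%SET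
  end.

(* Loops and parallel edges created by the contraction are suppressed. *)
Definition contract_edges : {set {set contract_vertex}} :=
  [set [set p.1; p.2] | p : contract_vertex * contract_vertex &
     (p.1 != p.2) &&
     [exists x in block p.1, exists y in block p.2, adj x y]]%SET.

Lemma contract_edges_card2 e : e \in contract_edges -> #|e| = 2.
Proof.
case/imsetP => -[u v]; rewrite inE /= => /andP[uv _] ->.
by rewrite cards2 uv.
Qed.

Definition contract_graph : graph := Graph contract_edges_card2.
End Contract.

Definition k_minor (k : nat) (H G : graph) : Prop :=
  exists (m : nat) (S : 'I_m -> subgraph G),
    [/\ forall i, gconnected (S i) /\ radius_le (S i) k,
        forall i j, i != j -> sub_verts (S i) :&: sub_verts (S j) = finset.set0 &
        exists T : subgraph (contract_graph S), iso H T].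

(* For a fixed G only finitely many values occur, at least one does (that of G
   itself), so this supremum is a maximum.  The null graph contributes
   0 / 0 = 0. *)
Definition nabla (R : realType) (k : nat) (G : graph) : R :=
  sup [set r : R | exists2 H : graph, k_minor k H G &
                   r = #|edges H|%:R / #|H|%:R].

(* Possibly +oo; it is -oo exactly for the empty class. *)
Definition nabla_class (R : realType) (k : nat) (C : graph -> Prop) : \bar R :=
  ereal_sup [set r : \bar R | exists2 G : graph, C G & r = (nabla R k G)%:E].

Definition bounds_expansion (R : realType) (f : nat -> R)
    (C : graph -> Prop) : Prop :=
  forall k : nat, (nabla_class R k C <= (f k)%:E)%E.

(* A limit equal to 0 forces nabla_class to be finite for large k, hence for
   all k by monotonicity; finiteness has to be stated because [fine] sends +oo
   to 0.  For classes without edges, where nabla_class is 0 (or -oo), the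
   convention ln 0 = 0 applies; otherwise nabla_class is at least 1/2 and ln is
   the true logarithm. *)
Definition subexponential_expansion (R : realType) (C : graph -> Prop) : Prop :=
  (forall k : nat, (nabla_class R k C < +oo)%E) /\
  (ln (fine (nabla_class R k C)) / k%:R @[k --> \oo] --> (0 : R)).

Definition is_separation (G : graph) (A B : subgraph G) : Prop :=
  [/\ sub_edges A :&: sub_edges B = finset.set0,
      sub_verts A :|: sub_verts B = [set: G]%SET &
      sub_edges A :|: sub_edges B = edges G].

Definition separation_size (G : graph) (A B : subgraph G) : nat :=
  #|sub_verts A :&: sub_verts B|.

Definition balanced (G : graph) (A B : subgraph G) : Prop :=
  (3 * #|sub_verts A :\: sub_verts B| <= 2 * #|G|)%N /\
  (3 * #|sub_verts B :\: sub_verts A| <= 2 * #|G|)%N.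

Definition separable (C : graph -> Prop) (n s : nat) : Prop :=
  forall G : graph, C G -> (#|G| <= n)%N ->
    exists A B : subgraph G,
      [/\ is_separation A B, balanced A B & (separation_size A B <= s)%N].

Lemma separable_exists (C : graph -> Prop) (n : nat) :
  exists s, `[< separable C n s >].
Proof.
exists n; apply/asboolP => G _ Gn.
have h1 e : e \in edges G -> e \subset [set: G]%SET by rewrite finset.subsetT.
have h2 (e : {set G}) : e \in finset.set0 -> e \subset [set: G]%SET by rewrite inE.
exists (Subgraph (subxx _) h1), (Subgraph (finset.sub0set _) h2); split.
- by split; rewrite /= ?finset.setI0 ?finset.setUid ?finset.setU0.
- by rewrite /balanced /= finset.setDv cards0 muln0.
- by rewrite /separation_size /= finset.setIid cardsT.
Qed.

Definition sep_number (C : graph -> Prop) (n : nat) : nat :=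
  ex_minn (separable_exists C n).

Definition strongly_sublinear_separators (R : realType) (C : graph -> Prop) : Prop :=
  exists c delta : R, [/\ 1 <= c, 0 <= delta, delta < 1 &
    forall n : nat, (sep_number C n)%:R <= c * n%:R `^ delta].

Definition subgraph_closed (C : graph -> Prop) : Prop :=
  forall G : graph, C G -> forall S : subgraph G, C S.

Definition bounded_max_degree (C : graph -> Prop) : Prop :=
  exists D : nat, forall G : graph, C G -> (max_degree G <= D)%N.

(* Main.v *)
(** Repeated separation shows that any [W] in a graph of the class can be broken
    into components of at most [t] vertices, with [t] polynomial in [q], by
    deleting at most [|W| / q] vertices.

    Let [H] be a [k]-minor of density larger than a suitable polynomial in [k].
    Bounded degree gives [log Delta(H) = O(k)], so a minimum-degree subgraph and a
    dyadic pigeonhole produce a bipartite piece [(A, B)] of [H] in which all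
    [a] in [A] have exactly [d] neighbours in [B] and no vertex of [B] exceeds
    its share of edges by more than a factor polynomial in [k].  Choose greedily
    [4 |B|] cherries [(a, b, c)], [b] and [c] being neighbours of [a], no vertex
    being used too often, while keeping small a potential that counts the ways in
    which many cherries may be redundant, that is have [b] and [c] already joined
    by earlier ones within a class of at most [t] vertices.  The paths of [G]
    realising the cherries form a set of [O(k |B|)] vertices; breaking it destroys
    at most half of the cherries, and since at most [|B|] of the survivors can
    merge classes, at least [|B|] are redundant.  This contradicts the potential
    bound unless [d = O(t)].  Hence the expansion is even polynomial in [k]. *)

Require Import Defs.
From HB Require Import structures.
From mathcomp Require Import all_boot all_order all_algebra.
From mathcomp Require Import zify ring lra.
Set Implicit Arguments.
Unset Strict Implicit.
Unset Printing Implicit Defensive.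

(** * Dense subgraphs with regular degrees *)

(** A smallest [W] spanning more than [d * #|W|] edges works: deleting a vertex of degree below [d]
    would leave a smaller such set. *)
Lemma min_degree_subset (V : finType) (E : {set {set V}}) (W0 : {set V}) d :
  (forall e, e \in E -> #|e| = 2) ->
  (forall e, e \in E -> e \subset W0) ->
  d * #|W0| < #|E| ->
  exists2 W : {set V}, W != set0 &
    forall w, w \in W -> d <= #|[set y in W | [set w; y] \in E]|.
Proof.
move=> E2 EW0 dE.
pose P (W : {set V}) := d * #|W| < #|[set e in E | e \subset W]|.
have P0 : P W0.
  apply: leq_trans dE _; apply: subset_leq_card.
  by apply/subsetP => e eE; rewrite inE eE EW0.
have [W PW minW] := @arg_minnP _ W0 P (fun W => #|W|) P0.
exists W.
  apply: contraTneq PW => ->; rewrite /P cards0 muln0 -leqNgt leqn0 cards_eq0.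
  apply/eqP/setP => e; rewrite !inE subset0; apply/negP => /andP[/E2].
  by move=> + /eqP e0; rewrite e0 cards0.
move=> w wW; rewrite leqNgt; apply/negP => ltd.
have : ~~ P (W :\ w).
  apply/negP => /minW; rewrite (cardsD1 w W) wW; lia.
rewrite /P -leqNgt.
have sub : [set e in E | e \subset W] \subset
   [set e in E | e \subset W :\ w] :|:
   [set [set w; y] | y in [set y in W | [set w; y] \in E]].
  apply/subsetP => e; rewrite !inE => /andP[eE eW]; rewrite eE subsetD1 eW /=.
  have [we|] := boolP (w \in e); rewrite ?orbT //=.
  have [x [y [_ def_e]]] := cards2P _ (introT eqP (E2 _ eE)).
  move: we; rewrite def_e !inE => /orP[]/eqP wE; subst w.
    apply/imsetP; exists y => //; rewrite !inE -def_e eE andbT.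
    by apply: (subsetP eW); rewrite def_e !inE eqxx orbT.
  apply/imsetP; exists x; last by rewrite setUC.
  rewrite !inE setUC -def_e eE andbT.
  by apply: (subsetP eW); rewrite def_e !inE eqxx.
have := leq_trans (subset_leq_card sub) (leq_card_setU _ _).
have := leq_imset_card (fun y => [set w; y]) [set y in W | [set w; y] \in E].
move: PW ltd; rewrite /P (cardsD1 w W) wW mulnDr muln1.
move: #|[set e in E | e \subset W]| #|[set y in W | _]| => m1 m2.
move: #|_| #|_| #|_| => m3 m4 m5.
lia.
Qed.

(** * Pigeonhole principle and counting of fibres *)

Section Pigeonhole.
Variable T : finType.

Definition subset_of_size n (S : {set T}) : {set T} := [set x in take n (enum S)].

Lemma subset_of_size_sub n S : subset_of_size n S \subset S.
Proof. by apply/subsetP => x; rewrite inE => /mem_take; rewrite mem_enum. Qed.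

Lemma card_subset_of_size n (S : {set T}) : n <= #|S| -> #|subset_of_size n S| = n.
Proof.
move=> nS; rewrite cardsE.
have /card_uniqP -> : uniq (take n (enum S)) by rewrite take_uniq ?enum_uniq.
by rewrite size_takel // -cardE.
Qed.

Lemma pigeonhole_class (S : {set T}) (L : nat) (g : T -> nat) :
  0 < L -> {in S, forall x, g x < L} ->
  exists2 i, i < L & #|S| <= L * #|[set x in S | g x == i]|.
Proof.
move=> L0 gL.
have eS : #|S| = \sum_(i < L) #|[set x in S | g x == i]|.
  rewrite -sum1_card; case: L L0 gL => // L _ gL.
  rewrite (partition_big (fun x => inord (g x) : 'I_L.+1) predT) //=.
  apply: eq_bigr => i _; rewrite -sum1_card; apply: eq_bigl => x.
  rewrite inE; have [xS /=|//] := boolP (x \in S).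
  by rewrite -val_eqE /= inordK // gL.
have [i _ maxi] := @arg_maxnP _ (Ordinal L0) predT
   (fun i : 'I_L => #|[set x in S | g x == i]|) isT.
exists i => //; rewrite eS.
apply: (@leq_trans (\sum_(j < L) #|[set x in S | g x == i]|)).
  by apply: leq_sum => j _; apply: maxi.
by rewrite sum_nat_const card_ord.
Qed.

Lemma sum_count_fibers (I : Type) (f : I -> T) (s : seq I) :
  \sum_v count (fun x => f x == v) s = size s.
Proof.
elim: s => [|x s IH] /=; first by rewrite big1.
rewrite big_split /= IH -add1n; congr (_ + _).
by rewrite (bigD1 (f x)) //= eqxx big1 ?addn0 // => v /negbTE; rewrite eq_sym => ->.
Qed.

Lemma card_saturated (I : Type) (f : I -> T) (s : seq I) K :
  K * #|[set v | K <= count (fun x => f x == v) s]| <= size s.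
Proof.
rewrite -(sum_count_fibers f) mulnC -sum_nat_const.
rewrite [X in _ <= X](bigID (mem [set v | K <= count (fun x => f x == v) s])) /=.
apply: leq_trans (leq_addr _ _).
by apply: leq_sum => v; rewrite inE.
Qed.

End Pigeonhole.

(* [B] is a dyadic class of vertices by degree; passing to a single class costs
   a factor [L] both in the degrees and in the number of vertices of [A]. *)
Lemma regular_pair (V : finType) (e : rel V) (W : {set V}) (L d : nat) :
  0 < L -> 0 < d -> W != set0 ->
  (forall b, #|[set a in W | e a b]| < 2 ^ L) ->
  (forall a, a \in W -> L * d <= #|[set b in W | e a b]|) ->
  exists (A B : {set V}) (N : V -> {set V}) (I : nat),
  [/\ A != set0,
      forall a, a \in A ->
        [/\ N a \subset B, #|N a| = d & forall b, b \in N a -> e a b],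
      forall b, #|[set a in A | b \in N a]| <= I,
      #|B| * I <= 2 * L ^ 2 * d * #|A| & #|B| <= L * #|A|].
Proof.
move=> L0 d0 W0 degL degd.
(* All out-degrees are cut down to exactly [L * d], so the number of kept pairs is known. *)
pose M a := subset_of_size (L * d) [set b in W | e a b].
have cardM a : a \in W -> #|M a| = L * d.
  by move=> aW; rewrite card_subset_of_size ?degd.
have Me a b : b \in M a -> (b \in W) && e a b.
  by move/(subsetP (subset_of_size_sub _ _)); rewrite inE.
pose indeg b := #|[set a in W | b \in M a]|.
have indegL b : indeg b < 2 ^ L.
  apply: leq_ltn_trans (degL b); apply: subset_leq_card.
  by apply/subsetP => a; rewrite inE => /andP[aW /Me/andP[_ ab]]; rewrite inE aW.
pose bk b := trunc_log 2 (indeg b).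
have bkL b : bk b < L.
  have [z|nz] := posnP (indeg b); first by rewrite /bk z.
  by rewrite -(@ltn_exp2l 2) //; apply: leq_ltn_trans (indegL b); apply: trunc_logP.
(* For each [a], one of the [L] dyadic in-degree classes contains [d] of its kept neighbours; a
   second pigeonhole then fixes one class [i] for many [a]. *)
pose good a i := d <= #|[set b in M a | bk b == i]|.
have ex_good a : a \in W -> has (good a) (iota 0 L).
  move=> aW; have [b _|i iL le] := @pigeonhole_class _ (M a) L bk L0; first exact: bkL.
  apply/hasP; exists i; first by rewrite mem_iota.
  by move: le; rewrite cardM // leq_pmul2l.
pose g a := find (good a) (iota 0 L).
have gL : {in W, forall a, g a < L}.
  by move=> a /ex_good; rewrite has_find size_iota.
have gg a : a \in W -> good a (g a).
  move=> aW; have := nth_find 0 (ex_good a aW).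
  by rewrite nth_iota ?add0n // gL.
have [i iL WA] := pigeonhole_class L0 gL.
set A := [set a in W | g a == i] in WA.
have AW a : a \in A -> a \in W by rewrite inE => /andP[].
(* As [trunc_log 2 0] is [0], in-degree zero must be excluded to have [2 ^ i <= indeg b] on all of
   [B]. *)
pose B := [set b in W | (0 < indeg b) && (bk b == i)].
pose N a := subset_of_size d [set b in M a | bk b == i].
have NM a b : b \in N a -> (b \in M a) && (bk b == i).
  by move/(subsetP (subset_of_size_sub _ _)); rewrite inE.
exists A, B, N, (2 ^ i.+1); split.
- apply: contraTneq WA => ->; rewrite cards0 muln0 -ltnNge card_gt0 //.
- move=> a aA; split.
  + apply/subsetP => b /NM/andP[bM bi]; have /andP[bW _] := Me _ _ bM.
    rewrite inE bW bi andbT /=; apply/card_gt0P; exists a.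
    by rewrite inE AW.
  + rewrite card_subset_of_size //; have := gg a (AW _ aA).
    by move: aA; rewrite inE => /andP[_ /eqP ->].
  + by move=> b /NM/andP[/Me/andP[_ ->]].
- move=> b; have [bi|nbi] := eqVneq (bk b) i; last first.
    rewrite (_ : [set _ in _ | _] = set0) ?cards0 //.
    apply/setP => a; rewrite inE in_set0; apply/negP => /andP[_ /NM/andP[_]].
    by rewrite (negbTE nbi).
  apply: leq_trans (_ : indeg b <= _); last first.
    by rewrite ltnW // -bi /bk trunc_log_ltn.
  apply: subset_leq_card; apply/subsetP => a.
  by rewrite inE => /andP[/AW aW /NM/andP[bM _]]; rewrite inE aW.
- have sumI : \sum_b indeg b = #|W| * (L * d).
    rewrite -sum_nat_const -(eq_bigr _ cardM).
    under eq_bigr do rewrite /indeg -sum1dep_card.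
    under [RHS]eq_bigr do rewrite -sum1_card.
    rewrite (exchange_big_dep (mem W)) /=; last by move=> b a _ /andP[].
    by apply: eq_bigr => a aW; apply: eq_bigl => b; rewrite aW.
  have le : #|B| * 2 ^ i <= #|W| * (L * d).
    rewrite -sumI -sum_nat_const [X in _ <= X](bigID (mem B)) /=.
    apply: leq_trans (leq_addr _ _); apply: leq_sum => b.
    by rewrite inE => /and3P[_ b0 /eqP <-]; apply: trunc_logP.
  rewrite expnS -mulnn (_ : #|B| * (2 * 2 ^ i) = 2 * (#|B| * 2 ^ i)); last by ring.
  apply: leq_trans (leq_mul (leqnn 2) (leq_trans le (leq_mul WA (leqnn _)))) _.
  by rewrite leq_eqVlt; apply/orP; left; apply/eqP; ring.
- by apply: leq_trans WA; apply: subset_leq_card; apply/subsetP => b; rewrite inE => /andP[].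
Qed.

(** * Cherry sequences of small potential *)

Section Sampling.
Variables (V : finType) (A B : {set V}) (N : V -> {set V}) (d t theta : nat).
Hypothesis N_B : forall a, a \in A -> N a \subset B.
Hypothesis card_N : forall a, a \in A -> #|N a| = d.

Implicit Types (x : V * V * V) (s : seq (V * V * V)).

(** The leaves may coincide, so a centre with [d] neighbours carries exactly [d * d] cherries. *)
Definition is_cherry x : bool :=
  [&& x.1.1 \in A, x.1.2 \in N x.1.1 & x.2 \in N x.1.1].

(** A labelling stands for the partition of [V] into its level sets. *)
Definition labelling := {ffun V -> V}.

Definition merge (lab : labelling) (b c : V) : labelling :=
  [ffun y => if lab y == lab b then lab c else lab y].

Definition joined (lab : labelling) x : bool :=
  (lab x.1.2 == lab x.2) && (#|[set y in B | lab y == lab x.1.2]| <= t).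

(* A cherry [(a, b, c)] either is discarded, or joins the classes of [b] and
   [c], or is redundant because [b] and [c] are already in the same class; the
   redundant ones are counted. *)
Definition step x (st : labelling * nat) : seq (labelling * nat) :=
  [:: st; (merge st.1 x.1.2 x.2, st.2)] ++
  nseq (joined st.1 x) (st.1, st.2.+1).

(** The head of [s] is the newest cherry. All histories are listed, with repetition, starting from
    the partition into singletons. *)
Fixpoint states s : seq (labelling * nat) :=
  if s is x :: s' then flatten [seq step x st | st <- states s']
  else [:: ([ffun y => y], 0)].

(** A single history with many redundant cherries already makes this sum large. *)
Definition potential s : nat := \sum_(st <- states s) theta ^ st.2.

Lemma potential_cons x s :
  potential (x :: s) =
  \sum_(st <- states s) (2 * theta ^ st.2 + joined st.1 x * theta ^ st.2.+1).
Proof.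
rewrite /potential /= big_flatten big_map; apply: eq_bigr => st _.
rewrite /step big_cat /= !big_cons big_nil /= addn0 mul2n addnn; congr (_ + _).
by case: joined; rewrite /= ?big_seq1 ?big_nil ?mul1n.
Qed.

(** Divided by [#|A| * (d * d)], this is the expectation of [F] over a uniformly random cherry. *)
Definition sum_cherries (F : V * V * V -> nat) : nat :=
  \sum_(a in A) \sum_(b in N a) \sum_(c in N a) F (a, b, c).

Lemma leq_sum_cherries F1 F2 :
  (forall x, is_cherry x -> F1 x <= F2 x) -> sum_cherries F1 <= sum_cherries F2.
Proof.
move=> le; apply: leq_sum => a aA; apply: leq_sum => b bN; apply: leq_sum => c cN.
by apply: le; rewrite /is_cherry aA bN cN.
Qed.

Lemma sum_cherriesD F1 F2 :
  sum_cherries (fun x => F1 x + F2 x) = sum_cherries F1 + sum_cherries F2.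
Proof.
rewrite /sum_cherries -big_split; apply: eq_bigr => a _ /=.
by rewrite -big_split; apply: eq_bigr => b _ /=; rewrite -big_split.
Qed.

Lemma sum_cherriesZ k F :
  sum_cherries (fun x => k * F x) = k * sum_cherries F.
Proof.
rewrite /sum_cherries big_distrr; apply: eq_bigr => a _ /=.
by rewrite big_distrr; apply: eq_bigr => b _ /=; rewrite big_distrr.
Qed.

Lemma sum_cherries1 : sum_cherries (fun => 1) = #|A| * (d * d).
Proof.
rewrite /sum_cherries -sum_nat_const; apply: eq_bigr => a aA.
under eq_bigr do rewrite sum1_card card_N //.
by rewrite sum_nat_const card_N.
Qed.

Lemma exchange_sum_cherries (I : Type) (r : seq I) (F : I -> V * V * V -> nat) :
  sum_cherries (fun x => \sum_(i <- r) F i x) = \sum_(i <- r) sum_cherries (F i).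
Proof.
elim: r => [|i r IH].
  rewrite big_nil /sum_cherries big1 // => a _.
  by rewrite big1 // => b _; rewrite big1 // => c _; rewrite big_nil.
rewrite big_cons -IH -sum_cherriesD /sum_cherries.
by do 3![apply: eq_bigr => ? _]; rewrite big_cons.
Qed.

(** Given [a] and [b], the leaf [c] must lie in the class of [b], which meets [B] in at most [t]
    vertices. *)
Lemma sum_cherries_joined lab :
  sum_cherries (fun x => joined lab x) <= #|A| * (d * t).
Proof.
rewrite /sum_cherries -sum_nat_const; apply: leq_sum => a aA.
rewrite -(card_N aA) -sum_nat_const; apply: leq_sum => b bN.
rewrite /joined /=; have [le|gt] := leqP #|[set y in B | lab y == lab b]| t; last first.
  by rewrite big1 // => c _; rewrite andbF.
apply: leq_trans le; rewrite -sum1_card.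
rewrite [X in _ <= X](bigID (mem (N a))) /=; apply: leq_trans (leq_addr _ _).
rewrite big_mkcond [X in _ <= X]big_mkcond /=; apply: leq_sum => c _.
rewrite andbT eq_sym inE; have [cN|//] := boolP (c \in N a).
by rewrite (subsetP (N_B aA)) //=; case: eqP.
Qed.

(** On average a new cherry multiplies the potential by at most 3: discarding and merging contribute
    2, while redundancy, of weight [theta] and probability at most [t / d], contributes at most
    1. *)
Lemma sum_cherries_potential s : theta * t <= d ->
  sum_cherries (fun x => potential (x :: s)) <= 3 * (#|A| * (d * d)) * potential s.
Proof.
move=> td.
under [X in X <= _]eq_bigr do under eq_bigr do under eq_bigr do rewrite potential_cons.
rewrite -[X in X <= _]/(sum_cherries (fun x => \sum_(st <- states s) _)).
rewrite exchange_sum_cherries /potential big_distrr /=; apply: leq_sum => st _.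
rewrite sum_cherriesD.
have -> : sum_cherries (fun=> 2 * theta ^ st.2) = 2 * (#|A| * (d * d)) * theta ^ st.2.
  rewrite -sum_cherries1 mulnAC -sum_cherriesZ.
  by do 3![apply: eq_bigr => ? _]; rewrite muln1.
have -> : sum_cherries (fun x => joined st.1 x * theta ^ st.2.+1) =
  theta ^ st.2 * theta * sum_cherries (fun x => joined st.1 x).
  by rewrite -sum_cherriesZ -expnSr; do 3![apply: eq_bigr => ? _]; rewrite mulnC.
have leM : sum_cherries (fun x => joined st.1 x) * theta <= #|A| * (d * d).
  apply: leq_trans (leq_mul (sum_cherries_joined _) (leqnn theta)) _.
  by rewrite -!mulnA !leq_mul2l [t * _]mulnC td !orbT.
rewrite (_ : 3 * _ * _ = 2 * (#|A| * (d * d)) * theta ^ st.2 +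
  theta ^ st.2 * (#|A| * (d * d))); last by ring.
by rewrite leq_add2l -mulnA leq_mul2l [theta * _]mulnC leM orbT.
Qed.

Definition uses (p : V * V * V -> V) s v : nat := count (fun x => p x == v) s.

Definition within_caps K s : Prop := forall v,
  [/\ uses (fun x => x.1.1) s v <= K, uses (fun x => x.1.2) s v <= K &
      uses snd s v <= K].

Lemma sum_cherries_saturated_center K s :
  K * sum_cherries (fun x => K <= uses (fun y => y.1.1) s x.1.1) <= size s * (d * d).
Proof.
have -> : sum_cherries (fun x => K <= uses (fun y => y.1.1) s x.1.1) =
   #|[set a in A | K <= uses (fun y => y.1.1) s a]| * (d * d).
  rewrite /sum_cherries -sum_nat_const [RHS]big_mkcond [LHS]big_mkcond /=.
  apply: eq_bigr => a _; rewrite inE; have [aA /=|//] := boolP (a \in A).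
  under eq_bigr do rewrite sum_nat_const card_N //.
  by rewrite sum_nat_const card_N //; case: leq; rewrite ?muln1 ?muln0.
rewrite mulnA leq_mul2r; apply/orP; right.
apply: leq_trans (card_saturated (fun y => y.1.1) s K); rewrite leq_mul2l.
by apply/orP; right; apply: subset_leq_card; apply/subsetP => a; rewrite !inE => /andP[].
Qed.

(** At most [size s / K] vertices are saturated, and each is a neighbour of at most [I] centres. *)
Lemma sum_cherries_saturated_leaf (p : V * V * V -> V) I K s :
  (forall b, #|[set a in A | b \in N a]| <= I) ->
  K * (\sum_(a in A) \sum_(b in N a) (K <= uses p s b)) <= size s * I.
Proof.
move=> NI.
have -> : \sum_(a in A) \sum_(b in N a) (K <= uses p s b) =
    \sum_(b in [set b | K <= uses p s b]) #|[set a in A | b \in N a]|.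
  rewrite (exchange_big_dep predT) //= [RHS]big_mkcond /=.
  apply: eq_bigr => b _; rewrite inE sum_nat_const.
  have -> : #|[set a in A | b \in N a]| = #|[pred a | (a \in A) && (b \in N a)]|.
    by apply: eq_card => a; rewrite !inE.
  by case: leq; rewrite ?muln1 ?muln0.
apply: leq_trans (leq_mul (card_saturated p s K) (leqnn I)).
by rewrite -mulnA leq_mul2l -sum_nat_const leq_sum ?orbT.
Qed.

(** Greedy choice: saturation spoils at most half of all cherries and the average growth over all of
    them is at most 3, so some unsaturated cherry multiplies the potential by at most 6. *)
Lemma exists_cherry_sequence I K n :
  0 < d -> A != set0 -> theta * t <= d ->
  (forall b, #|[set a in A | b \in N a]| <= I) ->
  6 * n <= K * #|A| -> 6 * n * I <= K * d * #|A| ->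
  exists s, [/\ size s = n, all is_cherry s, within_caps K s & potential s <= 6 ^ n].
Proof.
move=> d0 A0 td NI; elim: n => [|n IH] nA nI.
  exists [::]; split=> //.
  by rewrite /potential /= big_seq1.
have [||s [sn sA sK sP]] := IH; try by [apply: leq_trans nA; lia].
  by apply: leq_trans nI; rewrite leq_mul2r leq_mul2l leqnSn !orbT.
pose free x := [&& uses (fun y => y.1.1) s x.1.1 < K,
  uses (fun y => y.1.2) s x.1.2 < K & uses snd s x.2 < K].
set M := #|A| * (d * d).
have A1 : 0 < #|A| by rewrite card_gt0.
have M0 : 0 < M by rewrite !muln_gt0 A1 d0.
have K0 : 0 < K by case: (K) nA => // ; lia.
have few_center := sum_cherries_saturated_center K s.
have few_leaf p : K * (d * (\sum_(a in A) \sum_(b in N a) (K <= uses p s b))) * 6 <= K * M.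
  have := sum_cherries_saturated_leaf p K s NI.
  move: (\sum_(a in A) _) => S le; rewrite sn in le.
  have : d * (6 * (K * S)) <= d * (K * d * #|A|).
    rewrite leq_mul2l; apply/orP; right; apply: leq_trans nI.
    rewrite -mulnA leq_mul2l /=; apply: leq_trans le _.
    by rewrite leq_mul2r leqnSn orbT.
  rewrite /M; lia.
(* Each of the three roles is saturated in at most a sixth of the [M] cherries. *)
have few : 2 * sum_cherries (fun x => ~~ free x) <= M.
  have : sum_cherries (fun x => ~~ free x) <=
    sum_cherries (fun x => K <= uses (fun y => y.1.1) s x.1.1) +
    d * (\sum_(a in A) \sum_(b in N a) (K <= uses (fun y => y.1.2) s b)) +
    d * (\sum_(a in A) \sum_(b in N a) (K <= uses snd s b)).
    have -> : d * (\sum_(a in A) \sum_(b in N a) (K <= uses (fun y => y.1.2) s b)) =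
      sum_cherries (fun x => K <= uses (fun y => y.1.2) s x.1.2).
      rewrite big_distrr; apply: eq_bigr => a aA; rewrite big_distrr.
      by apply: eq_bigr => b _ /=; rewrite sum_nat_const card_N.
    have -> : d * (\sum_(a in A) \sum_(b in N a) (K <= uses snd s b)) =
      sum_cherries (fun x => K <= uses snd s x.2).
      rewrite big_distrr; apply: eq_bigr => a aA.
      by rewrite /= sum_nat_const card_N.
    rewrite -!sum_cherriesD; apply: leq_sum_cherries => x _.
    by rewrite /free !negb_and -!leqNgt; do 3!case: (K <= _).
  have c1 : K * sum_cherries (fun x => K <= uses (fun y => y.1.1) s x.1.1) * 6 <= K * M.
    apply: leq_trans (leq_mul few_center (leqnn 6)) _; rewrite sn /M.
    have : 6 * n * (d * d) <= K * #|A| * (d * d).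
      by rewrite leq_mul2r; apply/orP; right; apply: leq_trans nA; rewrite leq_mul2l leqnSn.
    lia.
  have := few_leaf (fun y => y.1.2); have := few_leaf snd.
  move: c1; rewrite -!mulnA !leq_pmul2l //.
  lia.
have [x xA [xfree xP]] : exists2 x, is_cherry x & free x /\ potential (x :: s) <= 6 * potential s.
  pose found := [exists x, [&& is_cherry x, free x & potential (x :: s) <= 6 * potential s]].
  have [/existsP[x /and3P[? ? ?]]|] := boolP found; first by exists x.
  (* Otherwise the free cherries, at least [M / 2] in number, would alone contribute more than
     [3 * M * potential s]. *)
  rewrite negb_exists => /forallP none; exfalso.
  have := sum_cherries_potential s td; rewrite -/M.
  have : (6 * potential s).+1 * sum_cherries free <=
    sum_cherries (fun x => potential (x :: s)).
    rewrite -sum_cherriesZ; apply: leq_sum_cherries => x xc.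
    have := none x; rewrite xc /= negb_and -ltnNge.
    by case: (free x) => //=; rewrite ?muln1 ?muln0.
  have : sum_cherries free + sum_cherries (fun x => ~~ free x) = M.
    rewrite /M -sum_cherries1 -sum_cherriesD.
    by do 3![apply: eq_bigr => ? _]; case: (free _).
  move: few M0; move: (potential s) (sum_cherries free) (sum_cherries _) (sum_cherries _).
  move=> P F nF S; nia.
exists (x :: s); split.
- by rewrite /= sn.
- by rewrite /= xA.
- move=> v; have [h1 h2 h3] := sK v; have /and3P[g1 g2 g3] := xfree.
  by rewrite /uses /= -!/(uses _ _ _); split; case: eqP => [<-|_] //.
- by apply: leq_trans xP _; rewrite expnS leq_mul2l sP.
Qed.

(** The history discards cherries outside [z], counts a cherry of [z] whose leaves share a label,
    and merges otherwise. Its labels always refine [comp], and each merge costs [B] one label. *)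
Lemma exists_state (T : eqType) (comp : V -> T) (z : pred (V * V * V)) s :
  (forall v, v \in B -> #|[set y in B | comp y == comp v]| <= t) ->
  (forall x, x \in s -> z x -> [/\ x.1.2 \in B, x.2 \in B & comp x.1.2 = comp x.2]) ->
  exists2 st, st \in states s &
    (forall y y', st.1 y = st.1 y' -> comp y = comp y') /\
    count z s + #|st.1 @: B| <= st.2 + #|B|.
Proof.
move=> small; elim: s => [|x s IH] sz.
  exists ([ffun y => y], 0); first by rewrite /= mem_seq1.
  split=> [y y'|]; rewrite /= ?ffunE; first by move=> ->.
  by rewrite leq_imset_card.
have [|st sts [labP cnt]] := IH.
  by move=> y ys; apply: sz; rewrite inE ys orbT.
have in_states st' : st' \in step x st -> st' \in states (x :: s).
  by move=> st'x; apply/flattenP; exists (step x st) => //; apply: map_f.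
have [zx|nzx] := boolP (z x); last first.
  exists st; first by apply: in_states; rewrite /step !inE eqxx.
  by rewrite /= (negbTE nzx).
have [bB cB bc] := sz x (mem_head _ _) zx.
have [eq_lab|neq_lab] := eqVneq (st.1 x.1.2) (st.1 x.2).
  exists (st.1, st.2.+1).
    apply: in_states; rewrite /step /joined eq_lab eqxx /=.
    (* The label class lies inside a class of [comp], hence is small enough for the cherry to count
       as redundant. *)
    suff -> : #|[set y in B | st.1 y == st.1 x.2]| <= t by rewrite !inE eqxx !orbT.
    apply: leq_trans (small _ bB); apply: subset_leq_card; apply/subsetP => y.
    by rewrite !inE => /andP[-> /eqP/labP ->]; rewrite bc /=.
  by split=> //=; rewrite zx add1n !addSn ltnS.
exists (merge st.1 x.1.2 x.2, st.2).
  by apply: in_states; rewrite /step !inE eqxx orbT.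
split=> [y y' /=|].
  rewrite !ffunE; case: eqP => [/labP ->|_]; case: eqP => [/labP -> //|_].
  - by move/labP <-.
  - by move/labP ->; rewrite -bc.
  - exact: labP.
rewrite /= zx; apply: leq_trans cnt; rewrite add1n addSnnS leq_add2l.
case: st {sts labP in_states} neq_lab => /= lab _ neq_lab.
(* After the merge the label of [x.1.2] no longer occurs. *)
rewrite (cardsD1 (lab x.1.2) (lab @: B)) imset_f //= ltnS.
apply: subset_leq_card; apply/subsetP => _ /imsetP[y yB ->].
rewrite !inE ffunE; case: ifPn => [_|->]; last by rewrite imset_f.
by rewrite eq_sym neq_lab imset_f.
Qed.

(** Merges absorb at most [#|B|] cherries of [z]; the others are redundant in a single history,
    whose weight gives the bound. *)
Lemma potential_bounds_survivors (T : eqType) (comp : V -> T)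
    (z : pred (V * V * V)) s r :
  0 < theta ->
  (forall v, v \in B -> #|[set y in B | comp y == comp v]| <= t) ->
  (forall x, x \in s -> z x -> [/\ x.1.2 \in B, x.2 \in B & comp x.1.2 = comp x.2]) ->
  r + #|B| <= count z s -> theta ^ r <= potential s.
Proof.
move=> theta0 small sz rB.
have [st sts [_ cnt]] := exists_state small sz.
have rst : r <= st.2.
  by rewrite -(leq_add2r #|B|); apply: leq_trans (leq_trans rB (leq_addr _ _)) cnt.
rewrite /potential (big_rem st) //=; apply: leq_trans (leq_addr _ _).
by rewrite leq_pexp2l.
Qed.

End Sampling.

(** * Breaking graphs along separators *)

Lemma adj_sym (G : graph) (x y : G) : adj x y = adj y x.
Proof. by rewrite /adj setUC. Qed.

Section InducedSubgraph.
Variables (G : graph) (W : {set G}).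

Lemma induced_edgesG : [set e in edges G | e \subset W] \subset edges G.
Proof. by apply/subsetP => e; rewrite inE => /andP[]. Qed.

Lemma induced_edges_verts e : e \in [set e in edges G | e \subset W] -> e \subset W.
Proof. by rewrite inE => /andP[]. Qed.

Definition induced : subgraph G := Subgraph induced_edgesG induced_edges_verts.

Lemma card_induced : #|graph_of_sub induced| = #|W|.
Proof. by rewrite card_sig; apply: eq_card => x. Qed.

Lemma adj_induced (x y : graph_of_sub induced) : adj x y = adj (val x) (val y).
Proof.
rewrite /adj inE imsetU1 imset_set1 inE.
case: (_ \in edges G) => //=; rewrite subUset !sub1set.
by rewrite (valP x) (valP y).
Qed.

End InducedSubgraph.

(** The separation is taken in the induced subgraph on [W], and [S] is the overlap of its sides. An
    edge from [P] to [Q] would lie in one of the sides, which misses one of its ends. *)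
Lemma separable_subset (C : graph -> Prop) n s (G : graph) (W : {set G}) :
  subgraph_closed C -> C G -> separable C n s -> #|W| <= n ->
  exists S P Q : {set G},
    [/\ S :|: P :|: Q = W, #|S| <= s,
        [/\ 3 * #|P| <= 2 * #|W|, 3 * #|Q| <= 2 * #|W| & #|P| + #|Q| <= #|W|] &
        forall x y, x \in P -> y \in Q -> ~~ adj x y].
Proof.
move=> Csub CG sepC Wn.
have [A [B [[_ AB EAB] [balA balB] AIB]]] :=
  sepC _ (Csub G CG (induced W)) (leq_trans (eq_leq (card_induced W)) Wn).
pose im (X : {set graph_of_sub (induced W)}) : {set G} := val @: X.
have card_im X : #|im X| = #|X| by rewrite card_imset //; exact: val_inj.
exists (im (sub_verts A :&: sub_verts B)), (im (sub_verts A :\: sub_verts B)),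
  (im (sub_verts B :\: sub_verts A)); split.
- rewrite /im -!imsetU.
  have -> : (sub_verts A :&: sub_verts B) :|: (sub_verts A :\: sub_verts B) :|:
    (sub_verts B :\: sub_verts A) = [set: graph_of_sub (induced W)].
    rewrite -AB; apply/setP => x; rewrite !inE.
    by do 2!case: (_ \in sub_verts _).
  apply/setP => x; apply/imsetP/idP => [[y _ ->]|xW]; first exact: (valP y).
  by exists (Sub x xW : graph_of_sub (induced W)).
- by rewrite card_im.
- rewrite !card_im -(card_induced W); split=> //.
  rewrite -cardsUI (_ : _ :&: _ = set0) ?cards0 ?addn0 ?max_card //.
  by apply/setP => x; rewrite !inE; do 2!case: (_ \in sub_verts _).
- move=> _ _ /imsetP[x xA ->] /imsetP[y yB ->]; rewrite -adj_induced.
  apply/negP; rewrite /adj -EAB inE => /orP[]/sub_edges_verts;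
    rewrite subUset !sub1set => /andP[hx hy].
    by move: yB; rewrite inE hy.
  by move: xA; rewrite inE hx.
Qed.

(* Deleting [x] vertices from [W] leaves components of at most [t] vertices;
   [f] names the component, or a union of components, of a vertex. *)
Definition breakable (G : graph) (t : nat) (W : {set G}) (x : nat) : Prop :=
  exists (X : {set G}) (f : G -> nat),
  [/\ #|X| <= x,
      forall y z, y \in W :\: X -> z \in W :\: X -> adj y z -> f y = f z &
      forall v, #|[set y in W :\: X | f y == v]| <= t].

Lemma breakable_small (G : graph) t (W : {set G}) : #|W| <= t -> breakable t W 0.
Proof.
move=> Wt; exists set0, (fun=> 0); split=> [||v]; rewrite ?cards0 //.
by apply: leq_trans Wt; apply: subset_leq_card; apply/subsetP => y; rewrite !inE => /andP[].
Qed.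

Lemma breakable_split (G : graph) t (W S P Q : {set G}) a b :
  S :|: P :|: Q = W -> (forall x y, x \in P -> y \in Q -> ~~ adj x y) ->
  breakable t P a -> breakable t Q b -> breakable t W (#|S| + a + b).
Proof.
move=> <- PQ [XP [fP [XPa fPadj fPt]]] [XQ [fQ [XQb fQadj fQt]]].
(* Even names go to [P] and odd names to the rest, so no class mixes the two sides and the bound [t]
   persists. *)
exists (S :|: XP :|: XQ), (fun y => if y \in P then (fP y).*2 else (fQ y).*2.+1).
have inPQ y : y \in (S :|: P :|: Q) :\: (S :|: XP :|: XQ) ->
  if y \in P then y \in P :\: XP else y \in Q :\: XQ.
  by rewrite !inE; do 5!case: (_ \in _).
split.
- by apply: leq_trans (leq_card_setU _ _) (leq_add (leq_trans (leq_card_setU _ _) _) _);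
    rewrite ?leq_add2l.
- move=> y z /inPQ + /inPQ; case: ifP => yP; case: ifP => zP.
  + by move=> yX zX /(fPadj _ _ yX zX) ->.
  + by rewrite [z \in _ :\: _]inE => _ /andP[_ zQ]; rewrite (negbTE (PQ _ _ _ _)).
  + rewrite [y \in _ :\: _]inE => /andP[_ yQ] _.
    by rewrite adj_sym (negbTE (PQ _ _ _ _)).
  + by move=> yX zX /(fQadj _ _ yX zX) ->.
- move=> v; case vodd: (odd v).
    apply: leq_trans (fQt v./2); apply: subset_leq_card; apply/subsetP => y.
    rewrite inE => /andP[/inPQ yX /eqP vE]; rewrite inE; move: yX vE; case: ifP => _.
      by move=> _ vE; move: vodd; rewrite -vE odd_double.
    by move=> -> <- /=; rewrite uphalf_double.
  apply: leq_trans (fPt v./2); apply: subset_leq_card; apply/subsetP => y.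
  rewrite inE => /andP[/inPQ yX /eqP vE]; rewrite inE; move: yX vE; case: ifP => _.
    by move=> -> <- /=; rewrite doubleK.
  by move=> _ vE; move: vodd; rewrite -vE /= odd_double.
Qed.

Lemma card_bigcup_leq (T : finType) (I : Type) (r : seq I) (P : pred I)
    (F : I -> {set T}) :
  #|\bigcup_(i <- r | P i) F i| <= \sum_(i <- r | P i) #|F i|.
Proof.
elim/big_rec2: _ => [|i n U _ le]; first by rewrite cards0.
by apply: leq_trans (leq_card_setU _ _) _; rewrite leq_add2l.
Qed.

Lemma degree_le_max (G : graph) (x : G) : degree x <= max_degree G.
Proof. exact: (leq_bigmax x). Qed.

(** * Balls in graphs of bounded degree *)

Section Balls.
Variables (G : graph) (D : nat).
Hypothesis GD : max_degree G <= D.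

Lemma card_neighborhood (W : {set G}) :
  #|\bigcup_(x in W) [set y | adj x y]| <= D * #|W|.
Proof.
apply: leq_trans (card_bigcup_leq _ _ _) _.
rewrite mulnC -sum_nat_const; apply: leq_sum => x _.
exact: leq_trans (degree_le_max x) GD.
Qed.

(** Replacing each vertex by its predecessor on a short path from [c] gives a set [W'] one step
    closer; [W] lies in [W'] and its neighbourhood. *)
Lemma card_ball k (c : G) (W : {set G}) :
  (forall x, x \in W -> dist_le k c x) -> #|W| <= D.+1 ^ k.
Proof.
elim: k W => [|k IH] W Wc.
  rewrite expn0 -(cards1 c); apply: subset_leq_card; apply/subsetP => x.
  by case/Wc => p [_ <-]; rewrite leqn0 size_eq0 => /eqP ->; rewrite inE.
suff [W' [W'c WW']] : exists W' : {set G}, (forall x, x \in W' -> dist_le k c x) /\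
    W \subset W' :|: \bigcup_(x in W') [set y | adj x y].
  apply: leq_trans (subset_leq_card WW') (leq_trans (leq_card_setU _ _) _).
  apply: leq_trans (leq_add (leqnn _) (card_neighborhood _)) _.
  by rewrite -mulSn expnS leq_mul2l IH ?orbT.
have : forall x : G, exists y : G, x \in W -> dist_le k c y /\ (x == y) || adj y x.
  move=> x.
  have [xW|] := boolP (x \in W); last by exists x.
  have [p [pp lp sp]] := Wc x xW.
  case/lastP: p pp lp sp => [|p z] pp lp sp.
    by exists c => _; split; [exists [::] | rewrite -lp /= eqxx].
  move: pp lp sp; rewrite rcons_path last_rcons size_rcons => /andP[pp pz] <- sp.
  by exists (last c p) => _; split; [exists p | rewrite pz orbT].
case/fin_all_exists => g gP.
exists (g @: W); split=> [_ /imsetP[x xW ->]|]; first by case: (gP x xW).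
apply/subsetP => x xW; have [_ /orP[/eqP xg|gx]] := gP x xW.
  by rewrite inE; apply/orP; left; apply/imsetP; exists x.
rewrite inE; apply/orP; right; apply/bigcupP; exists (g x); first exact: imset_f.
by rewrite inE.
Qed.

End Balls.

(** * Shallow minors *)

(* [join u v] is the vertex set of a path from [root u] to [root v]; its
   connectedness is expressed through the functions constant along its edges. *)
Record shallow_model (G : graph) (V : finType) (e : rel V) (k : nat)
    (blk : V -> {set G}) (root : V -> G) (join : V -> V -> {set G}) : Prop := {
  model_root : forall u, root u \in blk u;
  model_disjoint : forall u v x, x \in blk u -> x \in blk v -> u = v;
  model_card : forall u v, e u v -> #|join u v| <= 2 * k.+1;
  model_sub : forall u v, e u v -> join u v \subset blk u :|: blk v;
  model_ends : forall u v, e u v -> root u \in join u v /\ root v \in join u v;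
  model_conn : forall u v, e u v -> forall f : G -> nat,
    (forall x y, x \in join u v -> y \in join u v -> adj x y -> f x = f y) ->
    f (root u) = f (root v)
}.

Lemma const_along_path (G : graph) (f : G -> nat) (c : G) p :
  path (@adj G) c p ->
  (forall x y, x \in c :: p -> y \in c :: p -> adj x y -> f x = f y) ->
  f c = f (last c p).
Proof.
elim: p c => [//|z p IH] c /= /andP[cz pz] fP.
rewrite (fP c z) ?inE ?eqxx ?orbT //; apply: IH pz _ => x y xp yp.
by apply: fP; rewrite inE (xp, yp) orbT.
Qed.

Section ContractModel.
Variables (G : graph) (k m : nat) (S : 'I_m -> subgraph G).
Hypothesis S_radius : forall i, gconnected (S i) /\ radius_le (S i) k.
Hypothesis S_disjoint :
  forall i j, i != j -> sub_verts (S i) :&: sub_verts (S j) = set0.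

Lemma block_disjoint (u v : contract_vertex S) x :
  x \in block u -> x \in block v -> u = v.
Proof.
case: u v => [i|y] [j|z] /=.
- move=> xi xj; congr inl; apply/eqP; apply: contraT => /S_disjoint/setP/(_ x).
  by rewrite !inE xi xj.
- move=> xi; rewrite inE => /eqP xz; have := valP z.
  by move/bigcupP => []; exists i => //; move: xi; rewrite xz.
- rewrite inE => /eqP xy xj; have := valP y.
  by move/bigcupP => []; exists j => //; move: xj; rewrite xy.
- by rewrite !inE => /eqP -> /eqP/val_inj ->.
Qed.

Lemma block_center (u : contract_vertex S) : exists c, c \in block u /\
  forall x, x \in block u -> exists p, [/\ path (@adj G) c p, last c p = x,
    size p <= k & {subset p <= block u}].
Proof.
case: u => [i|y] /=; last first.
  exists (val y); split=> [|x]; first by rewrite inE.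
  by rewrite inE => /eqP ->; exists [::]; split.
have [_ [c cP]] := S_radius i.
exists (val c); split=> [|x xi]; first exact: (valP c).
have [p [pp lp sp]] := cP (Sub x xi).
exists (map val p); split.
- rewrite path_map; apply: sub_path pp => a b; rewrite /adj inE imsetU1 imset_set1.
  exact: (subsetP (sub_edgesG (S i))).
- by rewrite last_map lp.
- by rewrite size_map.
- by move=> _ /mapP[a _ ->]; apply: (valP a).
Qed.

Lemma adj_contractP (u v : contract_graph S) : adj u v ->
  exists x y, [/\ x \in block u, y \in block v & adj x y].
Proof.
case/imsetP => -[u' v']; rewrite inE /= => /andP[_ /existsP[x /andP[xu /existsP[y]]]].
case/andP=> yv xy uv.
have /orP[/eqP uE|/eqP uE] : (u == u') || (u == v').
- by have := set21 u v; rewrite uv !inE.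
- have : v' \in [set u; v] by rewrite uv !inE eqxx orbT.
  have : v \in [set u'; v'] by rewrite -uv !inE eqxx orbT.
  rewrite -uE !inE => /orP[]/eqP vE /orP[]/eqP v'E; exists x, y; subst; split=> //.
- have : u' \in [set u; v] by rewrite uv !inE eqxx.
  have : v \in [set u'; v'] by rewrite -uv !inE eqxx orbT.
  rewrite -uE !inE => /orP[]/eqP vE /orP[]/eqP u'E; exists y, x; rewrite adj_sym;
    subst; split=> //.
Qed.

(** For adjacent [u] and [v], join two touching vertices to the two centres inside the blocks: two
    paths of at most [k.+1] vertices each. The last two clauses serve to bound degrees in the
    minor. *)
Lemma contract_model : exists (blk : contract_graph S -> {set G}) root join,
  [/\ shallow_model (@adj (contract_graph S)) k blk root join,
      forall u x, x \in blk u -> dist_le k (root u) x &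
      forall u v : contract_graph S, adj u v ->
        exists x y, [/\ x \in blk u, y \in blk v & adj x y]].
Proof.
have [root rootP] := fin_all_exists block_center.
(* Adjacency is placed under the existential so that a total function [join] can be chosen over the
   finite type of pairs. *)
have ex_join (uv : contract_graph S * contract_graph S) : exists Q : {set G},
  adj uv.1 uv.2 -> [/\ #|Q| <= 2 * k.+1, Q \subset block uv.1 :|: block uv.2,
    root uv.1 \in Q /\ root uv.2 \in Q & forall f : G -> nat,
    (forall x y, x \in Q -> y \in Q -> adj x y -> f x = f y) ->
    f (root uv.1) = f (root uv.2)].
  case: uv => u v /=; have [uv|] := boolP (adj u v); last by exists set0.
  have [x [y [xu yv xy]]] := adj_contractP uv.
  have [ru /(_ x xu)[p [pp lp sp pu]]] := rootP u.
  have [rv /(_ y yv)[q [pq lq sq qv]]] := rootP v.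
  exists [set z in (root u :: p) ++ (root v :: q)] => _; split.
  - rewrite cardsE; apply: leq_trans (card_size _) _; rewrite size_cat /=; lia.
  - apply/subsetP => z; rewrite inE mem_cat !inE.
    case/orP=> /orP[/eqP ->|]; rewrite ?ru ?rv ?orbT //.
      by move/pu ->.
    by move/qv ->; rewrite orbT.
  - by split; rewrite inE mem_cat mem_head ?orbT.
  - move=> f fP.
    have fE a b : a \in (root u :: p) ++ (root v :: q) ->
      b \in (root u :: p) ++ (root v :: q) -> adj a b -> f a = f b.
      by move=> aQ bQ; apply: fP; rewrite inE.
    rewrite (const_along_path pp); last first.
      by move=> a b ap bp; apply: fE; rewrite mem_cat (ap, bp).
    rewrite (const_along_path pq); last first.
      by move=> a b ap bp; apply: fE; rewrite mem_cat (ap, bp) orbT.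
    rewrite lp lq; apply: fE => //; rewrite mem_cat.
      by rewrite -lp mem_last.
    by rewrite -lq mem_last orbT.
have [join joinP] := fin_all_exists ex_join.
exists (@block _ _ S), root, (fun u v => join (u, v)); split.
- split=> [u|u v x|u v uv|u v uv|u v uv|u v uv].
  + by case: (rootP u).
  + exact: block_disjoint.
  + by have [] := joinP (u, v) uv.
  + by have [] := joinP (u, v) uv.
  + by have [] := joinP (u, v) uv.
  + by have [] := joinP (u, v) uv.
- by move=> u x xu; have [_ /(_ x xu)[p [? ? ? _]]] := rootP u; exists p.
- by move=> u v; apply: adj_contractP.
Qed.

End ContractModel.

Lemma count_le_sum (I : eqType) (T : finType) (X : {set T}) (p : pred I)
    (g : T -> pred I) (s : seq I) :
  (forall x, x \in s -> p x -> exists2 y, y \in X & g y x) ->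
  count p s <= \sum_(y in X) count (g y) s.
Proof.
elim: s => [//|x s IH] pX /=; rewrite big_split /= leq_add ?IH //; last first.
  by move=> z zs; apply: pX; rewrite inE zs orbT.
case px: (p x) => //; have [y yX gy] := pX x (mem_head _ _) px.
by rewrite (bigD1 y) //= gy leq_addr.
Qed.

(** * Cherries that survive the breaking of their supports *)

Section SurvivingCherries.
Variables (G : graph) (V : finType) (e : rel V) (k : nat).
Variables (blk : V -> {set G}) (root : V -> G) (join : V -> V -> {set G}).
Hypothesis model : shallow_model e k blk root join.

Definition support (x : V * V * V) : {set G} :=
  join x.1.1 x.1.2 :|: join x.1.1 x.2.

(** Blocks are disjoint, so [y] lies in at most one block [h], and a cherry through [y] uses [h] in
    one of three roles, each capped by [K]. *)
Lemma count_support K (s : seq (V * V * V)) (y : G) :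
  (forall x, x \in s -> e x.1.1 x.1.2 /\ e x.1.1 x.2) -> within_caps K s ->
  count (fun x => y \in support x) s <= 3 * K.
Proof.
move=> se sK.
have in_blk x : x \in s -> y \in support x ->
    [|| y \in blk x.1.1, y \in blk x.1.2 | y \in blk x.2].
  move=> /se[e1 e2]; rewrite inE => /orP[/(subsetP (model_sub model e1))|
    /(subsetP (model_sub model e2))]; rewrite inE => /orP[->|->]; by rewrite ?orbT.
have [/existsP[h yh]|none] := boolP [exists h, y \in blk h]; last first.
  rewrite (@eq_in_count _ _ pred0) ?count_pred0 // => x xs.
  apply/negP => /(in_blk x xs) yx; move: none; rewrite negb_exists => /forallP none.
  by move: yx; rewrite !(negbTE (none _)).
have [c1 c2 c3] := sK h.
have le3 : count (fun x => y \in support x) s <=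
  uses (fun x => x.1.1) s h + uses (fun x => x.1.2) s h + uses snd s h.
  rewrite /uses; elim: s {se sK c1 c2 c3} in_blk => [//|x s IH] in_blk /=.
  have {}IH := IH (fun z zs => in_blk z (mem_behead (s := x :: s) zs)).
  have : (y \in support x : nat) <= (x.1.1 == h) + (x.1.2 == h) + (x.2 == h).
    have [yx|//] := boolP (y \in support x).
    have /or3P[/(model_disjoint model yh)|/(model_disjoint model yh)|
      /(model_disjoint model yh)] := in_blk x (mem_head _ _) yx;
      by move=> <-; rewrite eqxx ?addn1 ?addnS.
  lia.
apply: leq_trans le3 _; lia.
Qed.

(** The supports cover at most [4 * k.+1 * n] vertices, so breaking deletes at most [n / (6 * K)] of
    them. Each deleted vertex destroys at most [3 * K] cherries, hence at most half of them die. *)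
Lemma surviving_cherries K q t n (s : seq (V * V * V)) :
  0 < t -> q = 24 * K * k.+1 -> size s = n ->
  (forall x, x \in s -> e x.1.1 x.1.2 /\ e x.1.1 x.2) -> within_caps K s ->
  (forall W : {set G}, exists2 a, q * a <= #|W| & breakable t W a) ->
  exists (T : eqType) (comp : V -> T) (z : pred (V * V * V)),
    [/\ forall (B : {set V}) v, #|[set y in B | comp y == comp v]| <= t,
        forall x, x \in s -> z x -> comp x.1.2 = comp x.2 &
        n <= 2 * count z s].
Proof.
move=> t0 qE sn se sK frag.
pose U := \bigcup_(x <- s) support x.
have [a qa [X [f [Xa fadj ft]]]] := frag U.
have UL : #|U| <= n * (4 * k.+1).
  apply: leq_trans (card_bigcup_leq _ _ _) _.
  rewrite -sn -[X in X * _](count_predT s) -sum1_count big_distrl /= big_seq.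
  rewrite [X in _ <= X]big_seq; apply: leq_sum => x /se[e1 e2].
  apply: leq_trans (leq_card_setU _ _) _.
  rewrite mul1n (_ : 4 * _ = 2 * k.+1 + 2 * k.+1); last by ring.
  exact: leq_add (model_card model e1) (model_card model e2).
pose z x := [disjoint support x & X].
pose alive v := root v \in U :\: X.
(* A vertex whose root is deleted or lies outside [U] forms a class of its own; the [0] is
   padding. *)
pose comp v := if alive v then (f (root v), None) else (0, Some v).
have root_inj v w : root v = root w -> v = w.
  move=> vw; apply: (model_disjoint model (model_root model v)).
  by rewrite vw; exact: (model_root model w).
exists _, comp, z; split.
- move=> B v; rewrite /comp; case: ifP => [av|nav].
    apply: leq_trans (ft (f (root v))); rewrite -(card_imset _ root_inj).
    apply: subset_leq_card; apply/subsetP => _ /imsetP[y + ->].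
    rewrite inE => /andP[_]; case: ifP => [ay /eqP[fy]|_ /eqP//].
    by rewrite inE fy eqxx andbT; exact: ay.
  apply: leq_trans t0; rewrite -(cards1 v); apply: subset_leq_card.
  apply/subsetP => y; rewrite !inE => /andP[_]; by case: ifP => [_ /eqP//|_ /eqP[->]].
- move=> x xs zx; have [e1 e2] := se x xs.
  have suppUX y : y \in support x -> y \in U :\: X.
    move=> yx; rewrite inE (disjointFr zx yx) /=.
    by rewrite /U bigcup_seq; apply/bigcupP; exists x.
  (* The two paths of a surviving cherry lie in [U :\: X] and meet in the root of the centre, so [f]
     agrees on the roots of the leaves. *)
  have fsub g w : g = join x.1.1 w -> g \subset support x -> e x.1.1 w ->
      f (root x.1.1) = f (root w) /\ alive w.
    move=> -> /subsetP sub xw; split.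
      apply: (model_conn model xw) => y y' /sub/suppUX yU /sub/suppUX y'U.
      exact: fadj.
    by apply/suppUX/sub; have [] := model_ends model xw.
  have [f1 a1] := fsub _ _ erefl (subsetUl _ _) e1.
  have [f2 a2] := fsub _ _ erefl (subsetUr _ _) e2.
  by rewrite /comp a1 a2 -f1 -f2.
- have dead : count (predC z) s <= 3 * K * #|X|.
    apply: leq_trans (@count_le_sum _ _ X _ (fun y x => y \in support x) _ _) _.
      move=> x _; rewrite /= /z -setI_eq0 => /set0Pn[y]; rewrite inE => /andP[yx yX].
      by exists y.
    rewrite mulnC -sum_nat_const; apply: leq_sum => y _.
    exact: count_support.
  have := count_predC z s; rewrite sn => cn.
  have : 24 * K * k.+1 * #|X| <= n * (4 * k.+1).
    by rewrite -qE; apply: leq_trans UL; apply: leq_trans qa; rewrite leq_mul2l Xa orbT.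
  rewrite (_ : 24 * _ * _ * _ = k.+1 * (4 * (6 * K * #|X|))); last by ring.
  rewrite (_ : n * _ = k.+1 * (4 * n)); last by ring.
  rewrite !leq_pmul2l //.
  move: dead cn; rewrite -!mulnA; move: (K * #|X|) (count _ _) (count _ _).
  lia.
Qed.

End SurvivingCherries.

(** * Density bound for the minors of a breakable graph *)

Section ExpansionBound.
Variables (G : graph) (D k t : nat).
Hypothesis GD : max_degree G <= D.
Hypothesis t0 : 0 < t.
(** In-degrees in the minor will be below [2 ^ L], whence [L] dyadic classes. The cap [K] is what
    choosing [4 * #|B|] cherries requires: [24 * (2 * L ^ 2)]. *)
Let L := D.+1 * k.+1.
Let K := 48 * L ^ 2.
Hypothesis G_breakable :
  forall W : {set G}, exists2 a, 24 * K * k.+1 * a <= #|W| & breakable t W a.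

(** Of [4 * #|B|] cherries at least [2 * #|B|] survive, so the potential is at least [1297 ^ #|B|];
    but it is at most [6 ^ (4 * #|B|)], and [1297 = 6 ^ 4 + 1]. *)
Lemma no_regular_pair (V : finType) (e : rel V) blk root join
    (A B : {set V}) (N : V -> {set V}) (I : nat) :
  @shallow_model G V e k blk root join -> A != set0 ->
  (forall a, a \in A ->
    [/\ N a \subset B, #|N a| = 1297 * t & forall b, b \in N a -> e a b]) ->
  (forall b, #|[set a in A | b \in N a]| <= I) ->
  #|B| * I <= 2 * L ^ 2 * (1297 * t) * #|A| -> #|B| <= L * #|A| -> False.
Proof.
move=> model A0 NP NI BI BA.
have L0 : 0 < L by rewrite muln_gt0.
have NB a : a \in A -> N a \subset B by case/NP.
have cN a : a \in A -> #|N a| = 1297 * t by case/NP.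
have Bn0 : 0 < #|B|.
  have [a aA] := set0Pn _ A0; apply: leq_trans (subset_leq_card (NB a aA)).
  by rewrite cN // muln_gt0 t0.
have [|||s [sn sA sK sP]] := @exists_cherry_sequence V A B N (1297 * t) t 1297 NB cN
  I K (4 * #|B|) _ A0 (leqnn _) NI; first by rewrite muln_gt0 t0.
- rewrite mulnA; apply: leq_trans (leq_mul (leqnn (6 * 4)) BA) _.
  rewrite mulnA leq_mul2r; apply/orP; right; rewrite /K -mulnn; nia.
- rewrite (_ : 6 * _ * _ = 24 * (#|B| * I)); last by ring.
  apply: leq_trans (leq_mul (leqnn 24) BI) _; rewrite /K.
  by rewrite leq_eqVlt; apply/orP; left; apply/eqP; ring.
have se x : x \in s -> [/\ x.1.2 \in B, x.2 \in B, e x.1.1 x.1.2 & e x.1.1 x.2].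
  move=> xs; have /and3P[aA bN cN'] := allP sA x xs; have [/subsetP sub _ eN] := NP _ aA.
  by split; [exact: sub | exact: sub | exact: eN | exact: eN].
have [|T [comp [z [small zP cz]]]] :=
  surviving_cherries model t0 erefl sn _ sK G_breakable.
  by move=> x /se[].
have : 1297 ^ #|B| <= potential B t 1297 s.
  apply: (@potential_bounds_survivors V B t 1297 T comp z) => //.
    by move=> x xs zx; have [? ? _ _] := se x xs; rewrite (zP x).
  by move: cz; lia.
apply/negP; rewrite -ltnNge; apply: leq_ltn_trans sP _.
by rewrite expnM ltn_exp2r.
Qed.

(** A denser minor would contain a set of minimum degree [L * (1297 * t)], from which [regular_pair]
    extracts a pair excluded by [no_regular_pair]. *)
Lemma edges_minor_le H :
  k_minor k H G -> #|edges H| <= L * (1297 * t) * #|H|.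
Proof.
move=> [m [S [Srad Sdisj [T [h hbij hadj]]]]].
have L0 : 0 < L by rewrite muln_gt0.
have hinj := bij_inj hbij.
have cardH : #|H| = #|sub_verts T|.
  by rewrite (bij_eq_card hbij) card_sig; apply: eq_card.
have cardE : #|edges H| <= #|sub_edges T|.
  pose g (E : {set H}) : {set contract_graph S} := [set val (h x) | x in E].
  have ginj : injective g by apply: imset_inj => x y /val_inj/hinj.
  rewrite -(card_imset _ ginj); apply: subset_leq_card.
  apply/subsetP => _ /imsetP[E EH ->].
  have [x [y [_ defE]]] := cards2P _ (introT eqP (edges_card2 EH)).
  have : adj (h x) (h y) by rewrite hadj /adj -defE.
  by rewrite /adj inE /g defE !imsetU1 !imset_set1.
rewrite leqNgt; apply/negP => dense.
have [|||W Wn0 Wdeg] := @min_degree_subset _ (sub_edges T) (sub_verts T) (L * (1297 * t)).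
- by move=> E /(subsetP (sub_edgesG T)); apply: edges_card2.
- exact: sub_edges_verts.
- by rewrite -cardH; apply: leq_trans dense cardE.
have [blk [root [join [model near touch]]]] := contract_model Srad Sdisj.
pose e : rel (contract_graph S) := fun u v => [set u; v] \in sub_edges T.
have eadj u v : e u v -> adj u v by apply: (subsetP (sub_edgesG T)).
have {}model : shallow_model e k blk root join.
  case: model => m1 m2 m3 m4 m5 m6.
  by split=> // u v /eadj; [exact: m3 | exact: m4 | exact: m5 | exact: m6].
(* Distinct neighbours of [b] contain distinct vertices adjacent to [blk b], a set of at most
   [D.+1 ^ k] vertices. *)
have degL (b : contract_graph S) : #|[set a in W | e a b]| < 2 ^ L.
  have ex_y (a : contract_graph S) : exists y : G, e a b ->
      y \in blk a /\ y \in \bigcup_(x in blk b) [set y | adj x y].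
    have [ab|] := boolP (e a b); last by exists (root a).
    have [x [y [xa yb xy]]] := touch _ _ (eadj _ _ ab).
    exists x => _; split=> //; apply/bigcupP; exists y => //.
    by rewrite inE adj_sym.
  have [g gP] := fin_all_exists ex_y.
  have ginj : {in [set a in W | e a b] &, injective g}.
    move=> u v; rewrite !inE => /andP[_ /gP[gu _]] /andP[_ /gP[gv _]] guv.
    by apply: (model_disjoint model gu); rewrite guv.
  have cardb : #|[set a in W | e a b]| <= D * D.+1 ^ k.
    rewrite -(card_in_imset ginj).
    apply: leq_trans (_ : #|\bigcup_(x in blk b) [set y | adj x y]| <= _).
      apply: subset_leq_card; apply/subsetP => _ /imsetP[u + ->].
      by rewrite inE => /andP[_ /gP[]].
    apply: leq_trans (card_neighborhood GD _) _; rewrite leq_mul2l.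
    by rewrite (card_ball GD (near b)) orbT.
  apply: leq_ltn_trans cardb _.
  have : D * D.+1 ^ k < D.+1 ^ k.+1 by rewrite expnS ltn_pmul2r ?expn_gt0.
  move/leq_trans; apply; rewrite /L expnM leq_exp2r //.
  by rewrite expnS; have := ltn_expl D (isT : 1 < 2); lia.
have [|A [B [N [I [An0 NP NI BI BA]]]]] :=
  @regular_pair _ e W L (1297 * t) L0 _ Wn0 degL Wdeg.
  by rewrite muln_gt0 t0.
exact: no_regular_pair model An0 NP NI BI BA.
Qed.

End ExpansionBound.

(** Keeping one edge and its two ends gives density at least [1 / 2], which later bounds the
    logarithm from below. *)
Lemma single_edge_minor (k : nat) (H G : graph) :
  k_minor k H G -> 0 < #|edges H| ->
  exists H', [/\ k_minor k H' G, 0 < #|edges H'| & #|H'| = 2].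
Proof.
move=> [m [S [Srad Sdisj [T [h _ hadj]]]]] /card_gt0P[e eH].
have [x [y [_ defe]]] := cards2P _ (introT eqP (edges_card2 eH)).
have : adj (h x) (h y) by rewrite hadj /adj -defe.
rewrite /adj inE imsetU1 imset_set1; set u := val (h x); set v := val (h y) => uvT.
have uvS : [set u; v] \in edges (contract_graph S) by apply: (subsetP (sub_edgesG T)).
have sub1 : [set [set u; v]] \subset edges (contract_graph S) by rewrite sub1set.
have sub2 E : E \in [set [set u; v]] -> E \subset [set u; v] by rewrite inE => /eqP ->.
pose T' := Subgraph sub1 sub2.
exists (graph_of_sub T'); split.
- exists m, S; split=> //; exists T'; exists id => //; by exists id.
- have uP : u \in [set u; v] by rewrite !inE eqxx.
  have vP : v \in [set u; v] by rewrite !inE eqxx orbT.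
  apply/card_gt0P; exists [set (Sub u uP : graph_of_sub T'); Sub v vP].
  by rewrite inE imsetU1 imset_set1 !SubK inE.
- have <- : #|[set u; v]| = 2 := edges_card2 uvS.
  by rewrite card_sig; apply: eq_card => z; rewrite !inE.
Qed.

From mathcomp Require Import all_classical all_reals all_analysis.
Import Order.TTheory GRing.Theory Num.Theory.
Import numFieldNormedType.Exports.
Local Open Scope classical_set_scope.
Local Open Scope ring_scope.

(** * Analytic estimates *)

Lemma sep_numberP (C : graph -> Prop) n : separable C n (sep_number C n).
Proof. by rewrite /sep_number; case: ex_minnP => s /asboolP. Qed.

Lemma breakable_geometric (R : realType) (C : graph -> Prop) (c delta : R)
    (t j : nat) (G : graph) (W : {set G}) :
  let rho := (3 / 2) `^ (delta - 1) in
  subgraph_closed C -> C G -> (0 < t)%N -> 0 <= c -> delta < 1 -> rho < 1 ->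
  (forall n : nat, (sep_number C n)%:R <= c * n%:R `^ delta) ->
  #|W|%:R <= t%:R * (3 / 2) ^+ j :> R ->
  exists2 a : nat, breakable t W a &
    a%:R <= c / (1 - rho) * t%:R `^ (delta - 1) * (1 - rho ^+ j) * #|W|%:R.
Proof.
move=> rho Csub CG t0 c0 d1 rho1 Csep.
have rho0 : 0 <= rho by apply: powR_ge0.
set b := t%:R `^ (delta - 1).
have b0 : 0 <= b by apply: powR_ge0.
have tR0 : 0 < t%:R :> R by rewrite ltr0n.
have h32 : 0 < 3 / 2 :> R by lra.
have r0 : 1 - rho != 0 by rewrite subr_eq0 eq_sym lt_eqF.
set c1 := c / (1 - rho).
have c1E : c = c1 * (1 - rho) by rewrite /c1 mulfVK.
have c10 : 0 <= c1 by rewrite divr_ge0 // subr_ge0 ltW.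
elim: j W => [|j IH] W Wle.
  exists 0%N; last by rewrite expr0 subrr mulr0 mul0r.
  by apply: breakable_small; rewrite -(ler_nat R); apply: le_trans Wle _; rewrite expr0 mulr1.
have rhoj0 : 0 <= rho ^+ j by apply: exprn_ge0.
have rhoj1 : rho ^+ j <= 1 by apply: exprn_ile1 => //; apply: ltW.
have [small|big] := leP (#|W|%:R : R) (t%:R * (3 / 2) ^+ j).
  have [a aW le] := IH W small; exists a => //; apply: le_trans le _.
  apply: ler_wpM2r => //; apply: ler_wpM2l; first exact: mulr_ge0.
  rewrite lerD2l lerN2 exprS ler_piMl // ltW //.
have [S [P [Q [SPQ Ss [PW QW PQW] PQadj]]]] :=
  separable_subset Csub CG (@sep_numberP C #|W|) (leqnn _).
have half (Z : {set G}) : (3 * #|Z| <= 2 * #|W|)%N -> #|Z|%:R <= t%:R * (3 / 2) ^+ j :> R.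
  rewrite -(ler_nat R) !natrM; move: Wle; rewrite exprS mulrCA.
  by move: (t%:R * _) #|Z|%:R #|W|%:R => M z w h1 h2; lra.
have [aP bP leP] := IH P (half P PW).
have [aQ bQ leQ] := IH Q (half Q QW).
exists (#|S| + aP + aQ)%N; first exact: breakable_split SPQ PQadj bP bQ.
have W0 : 0 < #|W|%:R :> R.
  by apply: le_lt_trans big; rewrite mulr_ge0 ?exprn_ge0 // ltW //; lra.
have leS : #|S|%:R <= c * (b * rho ^+ j) * #|W|%:R.
  have -> : c * (b * rho ^+ j) * #|W|%:R = c * (#|W|%:R * (t%:R * (3 / 2) ^+ j) `^ (delta - 1)).
    rewrite powRM ?(ltW tR0) ?exprn_ge0 // -(powR_mulrn j (ltW h32)).
    rewrite -powRrM (mulrC j%:R) powRrM powR_mulrn ?powR_ge0 // -/b -/rho; ring.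
  apply: le_trans (_ : (sep_number C #|W|)%:R <= _); first by rewrite ler_nat.
  apply: le_trans (Csep _) _; apply: ler_wpM2l => //.
  (* The exponent [delta - 1] is negative, so the lower bound [big] on [#|W|] turns into an upper
     bound on the power. *)
  have -> : #|W|%:R `^ delta = #|W|%:R * #|W|%:R `^ (delta - 1).
    rewrite -[X in X * _](powRr1 (ltW W0)) -powRD; last by rewrite (gt_eqF W0) implybT.
    by congr powR; ring.
  apply: ler_wpM2l; first exact: ltW.
  have M0 : 0 < t%:R * (3 / 2) ^+ j :> R by rewrite mulr_gt0 // exprn_gt0 //; lra.
  rewrite -(opprB 1 delta) !powRN lef_pV2 ?posrE ?powR_gt0 //.
  by apply: ge0_ler_powR; rewrite ?nnegrE ?(ltW M0) ?(ltW W0) ?(ltW big) // subr_ge0 ltW.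
have leSum : (#|P|%:R + #|Q|%:R : R) <= #|W|%:R by rewrite -natrD ler_nat.
rewrite !natrD; apply: le_trans (lerD (lerD leS leP) leQ) _.
set u := c1 * b * (1 - rho ^+ j) in leP leQ *.
have u0 : 0 <= u by apply: mulr_ge0; [exact: mulr_ge0 | rewrite subr_ge0].
apply: le_trans (_ : c * (b * rho ^+ j) * #|W|%:R + u * #|W|%:R <= _).
  by rewrite -addrA lerD2l -mulrDr; apply: ler_wpM2l.
rewrite /u {1}c1E exprS le_eqVlt; apply/orP; left; apply/eqP; ring.
Qed.

Lemma ge1Dhalf_expr (R : realType) (j : nat) : 1 + j%:R / 2 <= (3 / 2) ^+ j :> R.
Proof.
elim: j => [|j IH]; first by rewrite expr0 mul0r addr0.
rewrite exprS -natr1.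
have : 0 <= j%:R :> R by [].
lra.
Qed.

Lemma breakable_class (R : realType) (C : graph -> Prop) :
  subgraph_closed C -> strongly_sublinear_separators R C ->
  exists p c2 : nat, (0 < c2)%N /\ forall (q : nat) (G : graph) (W : {set G}),
    (0 < q)%N -> C G ->
    exists2 a, (q * a <= #|W|)%N & breakable ((c2 * q) ^ p) W a.
Proof.
move=> Csub [c [delta [c1 d0 d1 Csep]]].
have c0 : 0 <= c by apply: le_trans c1.
set rho := (3 / 2) `^ (delta - 1) : R.
have rho0 : 0 <= rho by apply: powR_ge0.
have rho1 : rho < 1.
  rewrite /rho -(opprB 1) powRN invf_lt1 ?powR_gt0 //; try lra.
  have h32 : (3 / 2 == 0 :> R) = false by apply: gt_eqF; lra.
  by rewrite /powR h32 expR_gt1 mulr_gt0 ?subr_gt0 // ln_gt0 //; lra.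
pose c2 := (Num.trunc (c / (1 - rho))).+1.
pose p := (Num.trunc ((1 - delta)^-1)).+1.
exists p, c2; split=> // q G W q0 CG.
set t := ((c2 * q) ^ p)%N.
have cq1 : (0 < c2 * q)%N by rewrite muln_gt0 q0.
have t0 : (0 < t)%N by rewrite expn_gt0 cq1.
(* By Bernoulli's inequality, [2 * #|W|] levels suffice. *)
have [|a aW le] := @breakable_geometric R C c delta t (2 * #|W|) G W Csub CG t0 c0 d1 rho1 Csep.
  have : 1 <= t%:R :> R by rewrite ler1n.
  have := ge1Dhalf_expr R (2 * #|W|); rewrite natrM.
  set y := _ ^+ _ => yP tP.
  have W0 : 0 <= #|W|%:R :> R by [].
  nra.
exists a => //; rewrite -(ler_nat R) natrM.
have rj0 : 0 <= 1 - rho ^+ (2 * #|W|) <= 1.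
  have : 0 <= rho ^+ (2 * #|W|) by apply: exprn_ge0.
  have : rho ^+ (2 * #|W|) <= 1 by apply: exprn_ile1 => //; apply: ltW.
  lra.
have cr0 : 0 <= c / (1 - rho) by rewrite divr_ge0 // subr_ge0 ltW.
have le' : a%:R <= c / (1 - rho) * t%:R `^ (delta - 1) * #|W|%:R.
  apply: le_trans le _; apply: ler_wpM2r => //; case/andP: rj0 => _ rj1.
  by apply: ler_piMr => //; rewrite mulr_ge0 // powR_ge0.
have tpow : (c2 * q)%:R <= t%:R `^ (1 - delta) :> R.
  rewrite /t natrX -powR_mulrn // -powRrM.
  have x1 : 1 <= (c2 * q)%:R :> R by rewrite ler1n.
  rewrite -[X in X <= _]powRr1; last exact: le_trans x1.
  apply: ler_powR => //.
  rewrite -ler_pdivrMr ?subr_gt0 // mul1r ltW // /p truncnS_gt //.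
have tp0 : 0 < t%:R `^ (1 - delta) :> R by rewrite powR_gt0 // ltr0n.
have cq : c / (1 - rho) * q%:R <= t%:R `^ (1 - delta).
  apply: le_trans tpow; rewrite natrM; apply: ler_wpM2r => //.
  by apply: ltW; apply: truncnS_gt.
apply: le_trans (ler_wpM2l _ le') _ => //.
rewrite -(opprB 1 delta) powRN.
rewrite (_ : q%:R * _ = c / (1 - rho) * q%:R / t%:R `^ (1 - delta) * #|W|%:R); last by ring.
by apply: ler_piMl => //; rewrite ler_pdivrMr // mul1r.
Qed.

(** Here [q] is cubic in [k.+1], so [t] has degree [3 * p]; the factor [L] raises the degree by
    one. *)
Lemma polynomial_expansion (R : realType) (C : graph -> Prop) :
  subgraph_closed C -> bounded_max_degree C -> strongly_sublinear_separators R C ->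
  exists c P : nat, forall (k : nat) (G H : graph), C G -> k_minor k H G ->
    (#|edges H| <= c * k.+1 ^ P * #|H|)%N.
Proof.
move=> Csub [D CD] /(breakable_class Csub)[p [c2 [c20 frag]]].
exists (1297 * D.+1 * (c2 * (24 * 48 * D.+1 ^ 2)) ^ p)%N, (3 * p).+1 => k G H CG HG.
pose L := (D.+1 * k.+1)%N.
pose q := (24 * (48 * L ^ 2) * k.+1)%N.
have q0 : (0 < q)%N by rewrite !muln_gt0.
pose t := ((c2 * q) ^ p)%N.
have t0 : (0 < t)%N by rewrite expn_gt0 muln_gt0 c20 q0.
have tE : t = ((c2 * (24 * 48 * D.+1 ^ 2)) ^ p * (k.+1 ^ 3) ^ p)%N.
  by rewrite /t -expnMn; congr (_ ^ _)%N; rewrite /q /L; ring.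
have := @edges_minor_le G D k t (CD G CG) t0 (fun W => frag q G W q0 CG) H HG.
congr (_ <= _ * _)%N.
by rewrite tE [(k.+1 ^ (3 * p).+1)%N]expnS expnM; move: (_ ^ p)%N (_ ^ p)%N => u v; ring.
Qed.

(** With [y] the power of [k] in the exponential, [k.+1 <= (1 + y) ^+ 2] and
    [1 + y <= n * expR (y / n)]; raising to powers gives the factor [n ^ n]. *)
Lemma polynomial_le_expR (R : realType) (c P : nat) :
  exists2 gamma : R, 1 <= gamma &
  forall k : nat, (c * k.+1 ^ P)%:R <= gamma * expR (k%:R `^ (3 / 4)).
Proof.
(* The successor keeps [n] positive when [P] is [0]. *)
pose n := (2 * P).+1.
exists (c%:R * n%:R ^+ n + 1) => [|k].
  by rewrite lerDr mulr_ge0 ?exprn_ge0.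
set y := k%:R `^ (3 / 4).
have y0 : 0 <= y by apply: powR_ge0.
have ky : k.+1%:R <= (1 + y) ^+ 2.
  suff : k%:R <= y ^+ 2 by rewrite -natr1 sqrrD expr1n; lra.
  case: k @y y0 => [|k] y y0; first by rewrite exprn_ge0.
  rewrite /y -powR_mulrn // -powRrM le1r_powR ?ler1n //; lra.
have n0 : 0 < n%:R :> R by rewrite ltr0n.
have n1 : 1 <= n%:R :> R by rewrite ler1n.
have ye : 1 + y <= n%:R * expR (y / n%:R).
  apply: le_trans (_ : n%:R * (1 + y / n%:R) <= _); last first.
    by rewrite ler_pM2l // expR_ge1Dx.
  by rewrite mulrDr mulr1 mulrCA divff ?gt_eqF // mulr1 lerD2r.
have : (1 + y) ^+ n <= n%:R ^+ n * expR y.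
  have e0 : 0 <= n%:R * expR (y / n%:R) by rewrite mulr_ge0 ?expR_ge0.
  apply: le_trans (lerXn2r n _ _ ye) _; rewrite ?nnegrE ?addr_ge0 //.
  by rewrite exprMn -expRM_natl mulrCA divff ?gt_eqF // mulr1.
move=> yn.
have kn : k.+1%:R ^+ P <= (1 + y) ^+ n.
  apply: le_trans (lerXn2r P _ _ ky) _; rewrite ?nnegrE ?exprn_ge0 ?addr_ge0 //.
  by rewrite -exprM ler_weXn2l // lerDl.
rewrite natrM natrX mulrDl -mulrA mul1r.
apply: le_trans (ler_wpM2l _ (le_trans kn yn)) _ => //.
by rewrite lerDl expR_ge0.
Qed.

(** * Suprema of densities and their logarithms *)

Lemma nabla_le (R : realType) (k : nat) (G : graph) (b : R) : 0 <= b ->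
  (forall H, k_minor k H G -> #|edges H|%:R / #|H|%:R <= b) -> nabla R k G <= b.
Proof.
move=> b0 Hb; rewrite /nabla; set S := [set r | _].
(* The supremum of the empty set is [0] by convention, which [0 <= b] covers. *)
have [->|/set0P S0] := eqVneq S set0; first by rewrite sup0.
by apply: ge_sup => // _ [H HG ->]; apply: Hb.
Qed.

Lemma ler_norm_ln (R : realType) (x g y : R) : 1 <= g -> 0 <= y ->
  2^-1 <= x -> x <= g * expR y -> `|ln x| <= 1 + ln g + y.
Proof.
move=> g1 y0 x2 xg.
have g0 : 0 < g by apply: lt_le_trans g1.
have x0 : 0 < x by apply: lt_le_trans x2; rewrite invr_gt0.
have lng : 0 <= ln g by apply: ln_ge0.
have up : ln x <= ln g + y.
  by rewrite -[y in leRHS]expRK -lnM ?posrE ?expR_gt0 // ler_ln ?posrE ?mulr_gt0 ?expR_gt0.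
have lo : -1 <= ln x.
  apply: le_trans (_ : ln 2^-1 <= _); last by rewrite ler_ln ?posrE ?invr_gt0.
  rewrite lnV ?posrE // lerN2; have : -1 < 1 :> R by lra.
  by move/le_ln1Dx.
rewrite ler_norml; apply/andP; split; lra.
Qed.

(** If some minor has an edge, the supremum is at least [1 / 2] and its logarithm is bounded on both
    sides. Otherwise it is at most [0], where [ln] takes the default value [0]. *)
Lemma nabla_class_ln (R : realType) (C : graph -> Prop) (k : nat) (g y : R) :
  1 <= g -> 0 <= y ->
  (forall G H, C G -> k_minor k H G -> #|edges H|%:R / #|H|%:R <= g * expR y) ->
  (nabla_class R k C <= (g * expR y)%:E)%E /\
  `|ln (fine (nabla_class R k C))| <= 1 + ln g + y.
Proof.
move=> g1 y0 bnd.
have gy0 : 0 <= g * expR y by rewrite mulr_ge0 ?expR_ge0 //; apply: le_trans g1.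
have le : (nabla_class R k C <= (g * expR y)%:E)%E.
  apply: ge_ereal_sup => _ [G CG ->]; rewrite lee_fin.
  by apply: nabla_le => // H; apply: bnd.
split=> //.
have [[G [H [CG HG E0]]]|none] := pselect (exists G H, [/\ C G, k_minor k H G &
    (0 < #|edges H|)%N]).
  have [H' [H'G E'0 H'2]] := single_edge_minor HG E0.
  have half : 2^-1 <= nabla R k G.
    apply: le_trans (_ : #|edges H'|%:R / #|H'|%:R <= _).
      by rewrite H'2 ler_peMl // ler1n.
    apply: ub_le_sup; last by exists H'.
    by exists (g * expR y) => _ [H'' H''G ->]; apply: bnd CG H''G.
  have : ((2^-1)%:E <= nabla_class R k C)%E.
    apply: le_trans (_ : (nabla R k G)%:E <= _)%E; first by rewrite lee_fin.
    by apply: ereal_sup_ubound; exists G.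
  case: nabla_class le => [x| |] //=; rewrite !lee_fin => xg x2.
  exact: ler_norm_ln.
have : (nabla_class R k C <= 0%:E)%E.
  apply: ge_ereal_sup => _ [G CG ->]; rewrite lee_fin.
  apply: nabla_le => // H HG; have [->|E0] := posnP #|edges H|; first by rewrite mul0r.
  by case: none; exists G, H.
have b0 : 0 <= 1 + ln g + y by have := ln_ge0 g1; lra.
case: nabla_class {le} => [x| |] //=; rewrite ?lee_fin => x0; rewrite ln0 ?normr0 //.
Qed.

Theorem theorem2 (R : realType) (C : graph -> Prop) :
  subgraph_closed C -> bounded_max_degree C ->
  strongly_sublinear_separators R C ->
  (exists gamma : R, 0 <= gamma /\
     bounds_expansion (fun k : nat => gamma * expR (k%:R `^ (3 / 4))) C) /\
  subexponential_expansion R C.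
Proof.
move=> Csub CD Csep.
have [c [P CE]] := polynomial_expansion Csub CD Csep.
have [g g1 gP] := polynomial_le_expR R c P.
have bnd k G H : C G -> k_minor k H G ->
    #|edges H|%:R / #|H|%:R <= g * expR (k%:R `^ (3 / 4)).
  move=> CG HG; apply: le_trans (gP k).
  have [H0|H0] := posnP #|H|; first by rewrite H0 invr0 mulr0.
  by rewrite ler_pdivrMr ?ltr0n // -natrM ler_nat (CE k G).
have key k := nabla_class_ln g1 (powR_ge0 k%:R (3 / 4)) (bnd k).
split.
  exists g; split=> [|k]; first exact: le_trans g1.
  by have [] := key k.
split=> [k|].
  by have [le _] := key k; apply: le_lt_trans le _; rewrite ltry.
apply/cvgr0Pnorm_le => eps eps0.
(* Since [y] will be at least 1, [1 + ln g + y <= M * y]. *)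
pose M := 2 + ln g; have M0 : 0 <= M by have := ln_ge0 g1; rewrite /M; lra.
near=> k.
have k4 : (M / eps) ^+ 4 <= k%:R.
  near: k; apply: nbhs_infty_ger.
have k1 : 1 <= k%:R :> R by near: k; apply: nbhs_infty_ger.
have k0 : 0 < k%:R :> R by apply: lt_le_trans k1.
have [_ le] := key k.
rewrite normrM normfV (ger0_norm (ltW k0)) ler_pdivrMr //.
apply: le_trans le _.
set y := k%:R `^ (3 / 4).
have y1 : 1 <= y by rewrite -[leLHS](powRr0 k%:R); apply: ler_powR => //; lra.
have root4 : M / eps <= k%:R `^ 4^-1.
  have x0 : 0 <= M / eps by rewrite divr_ge0 // ltW.
  have -> : M / eps = ((M / eps) ^+ 4) `^ 4^-1.
    by rewrite -powR_mulrn // -powRrM mulfV // powRr1.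
  by apply: ge0_ler_powR; rewrite ?nnegrE ?exprn_ge0 // ltW.
(* The spare factor, the fourth root of [k], exceeds [M / eps], so [M * y] is at most [eps * k]. *)
have -> : k%:R = k%:R `^ 4^-1 * y.
  rewrite -powRD ?(gt_eqF k0) ?implybT // -[LHS]powRr1 ?ltW //; congr powR; lra.
apply: le_trans (_ : M * y <= _).
  by have := ln_ge0 g1; rewrite /M => lng; nra.
rewrite mulrA; apply: ler_wpM2r; first exact: powR_ge0.
by rewrite mulrC -ler_pdivrMr.
Unshelve. all: by end_near.
Qed.
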